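(* Let $\langle X, \tau_X, \mathcal{I}_X\rangle$ and $\langle Y, \tau_Y, \mathcal{I}_Y\rangle$ be ideal topological spaces. If $f:\langle X, \tau_X\rangle \to \langle Y, \tau_Y\rangle$ is an open function and $f[I]\in \mathcal{I}_Y$ for all $I\in \mathcal{I}_X$, then $f:\langle X, \tau_X^*\rangle \to \langle Y, \tau_Y^*\rangle$ is an open function.
   Context: An ideal on a nonempty set $X$ is a family $\mathcal{I}\subseteq P(X)$ with $\emptyset\in\mathcal{I}$, closed under taking subsets and under unions of two members (it is not required to be proper: $X \in \mathcal{I}$ is allowed). An ideal topological space is a triple $\langle X,\tau,\mathcal{I}\rangle$ where $\langle X,\tau\rangle$ is a topological space and $\mathcal{I}$ is an ideal on $X$. No separation axioms are assumed. Write $\tau(x)$ for the family of open neighbourhoods of $x$. The local function is $A\mapsto A^*=\{x\in X: A\cap U\notin\mathcal{I}\text{ for each }U\in\tau(x)\}$. The operator $\mathrm{Cl}^*(A)=A\cup A^*$ is a closure operator on $P(X)$, and it generates the topology $\tau^*=\{U\subseteq X: \mathrm{Cl}^*(X\setminus U)=X\setminus U\}$. The topology $\tau_X^*$ is formed from $\tau_X$ and $\mathcal{I}_X$, and $\tau_Y^*$ from $\tau_Y$ and $\mathcal{I}_Y$. A function is open if it maps open sets to open sets; an open function is not assumed to be continuous. $f[A]$ denotes direct image. *)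

(* Defs.v *)
From HB Require Import structures.
From mathcomp Require Import all_boot all_order.
From mathcomp Require Import boolp classical_sets filter topology.

Set Implicit Arguments.
Unset Strict Implicit.
Unset Printing Implicit Defensive.

Local Open Scope classical_set_scope.

(* Not required to be proper: [I setT] is allowed. *)
Record ideal (X : Type) := Ideal {
  ideal_sets :> set X -> Prop;
  ideal0 : ideal_sets set0;
  ideal_sub : forall A B : set X, A `<=` B -> ideal_sets B -> ideal_sets A;
  idealU : setU_closed ideal_sets }.

(* An alias of [X] carrying the topology generated by the closure operator
   [star_closure] below, kept apart from the original topology of [X]. *)
Definition star_space (X : topologicalType) (I : ideal X) : Type := X.

Section StarTopology.
Variables (X : topologicalType) (I : ideal X).
Implicit Types A B U V : set X.

Definition local_function A : set X :=
  [set x | forall U, open_nbhs x U -> ~ I (A `&` U)].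

Definition star_closure A : set X := A `|` local_function A.

Definition star_open : set (set X) :=
  [set U | star_closure (~` U) = ~` U].

Lemma star_openP U :
  star_open U <-> forall x, U x -> exists2 V, open_nbhs x V & I (V `\` U).
Proof.
split=> [cU x Ux|hU].
  have : ~ local_function (~` U) x.
    by move=> lx; have : star_closure (~` U) x by [right]; rewrite cU.
  move=> /existsNP[V /not_implyP[oV /contrapT IV]].
  by exists V => //; rewrite setDE setIC.
apply/seteqP; split=> [x [//|lx] Ux|x nUx]; last by left.
have [V oV IV] := hU _ Ux.
by apply: (lx V oV); rewrite setIC -setDE.
Qed.

HB.instance Definition _ := Choice.copy (star_space I) X.

Let star_openT : star_open setT.
Proof.
apply/star_openP => x _; exists setT; last by rewrite setDT; exact: ideal0.
by split=> //; exact: openT.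
Qed.

Let star_openI : setI_closed star_open.
Proof.
move=> U V /star_openP hU /star_openP hV; apply/star_openP => x [Ux Vx].
have [W [oW Wx] IW] := hU _ Ux; have [W' [oW' W'x] IW'] := hV _ Vx.
exists (W `&` W'); first by split; [exact: openI|].
apply: ideal_sub (idealU IW IW') => y [[Wy W'y] /not_andP[nUy|nVy]].
  by left.
by right.
Qed.

Let star_open_bigU (J : Type) (F : J -> set X) :
  (forall j, star_open (F j)) -> star_open (\bigcup_j F j).
Proof.
move=> hF; apply/star_openP => x [j _ Fjx].
have [V oV IV] := (star_openP (F j)).1 (hF j) _ Fjx.
exists V => //; apply: ideal_sub IV => y [Vy nFy].
by split=> // Fjy; apply: nFy; exists j.
Qed.

HB.instance Definition _ :=
  isOpenTopological.Build (star_space I) star_openT star_openI star_open_bigU.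

Lemma open_star_spaceE : (@open (star_space I) : set (set X)) = star_open.
Proof. by []. Qed.

End StarTopology.

(* Continuity is not required. *)
Definition open_map (X Y : topologicalType) (f : X -> Y) : Prop :=
  forall U : set X, open U -> open (f @` U).

(* Main.v *)
Require Import Defs.
From mathcomp Require Import all_boot all_order.
From mathcomp Require Import boolp classical_sets filter topology.

(** A set [U] is open in the star topology iff each of its points has an
    ordinary open neighbourhood [V] contained in [U] up to a member of the
    ideal ([star_openP]). Both halves of this criterion pass to images: [f @` V]
    is an open neighbourhood of [f x], and whatever [f @` V] has outside
    [f @` U] comes from points of [V] outside [U], so it lies in the image of a
    set of the ideal. *)

Local Open Scope classical_set_scope.

Lemma image_setD_sub (X Y : Type) (f : X -> Y) (A B : set X) :
  f @` A `\` f @` B `<=` f @` (A `\` B).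
Proof.
by move=> _ [[x Ax <-] nBfx]; exists x => //; split=> // Bx; apply: nBfx; exists x.
Qed.

Theorem theorem11 (X Y : topologicalType)
    (X_nonempty : [set: X] !=set0) (Y_nonempty : [set: Y] !=set0)
    (IX : ideal X) (IY : ideal Y) (f : X -> Y) :
  open_map f ->
  (forall A : set X, IX A -> IY (f @` A)) ->
  open_map (f : star_space IX -> star_space IY).
Proof.
move=> f_open f_ideal U; rewrite !open_star_spaceE => /star_openP U_open.
apply/star_openP => _ [x Ux <-].
have [V [V_open Vx] IVU] := U_open x Ux.
exists (f @` V); first by split; [exact: f_open | exists x].
by apply: ideal_sub (f_ideal _ IVU); exact: image_setD_sub.
Qed.
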